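(* Let $m$ be a positive integer and $\lambda$ a nonzero real number. For every $n\ge0$, $$m^{n}\,\mathrm{Bel}_{n,\lambda/m}\!\left(\frac{x}{m}\right)=\sum_{k=0}^{n}\binom{n}{k}(-1)^{n-k}\langle 1\rangle_{n-k,\lambda}\,D_{m,\lambda}(k,x).$$
   Context: For a nonzero real $\mu$: $(x)_{0,\mu}=1$, $(x)_{n,\mu}=x(x-\mu)\cdots(x-(n-1)\mu)$; $\langle x\rangle_{0,\mu}=1$, $\langle x\rangle_{n,\mu}=x(x+\mu)\cdots(x+(n-1)\mu)$; $(x)_n=(x)_{n,1}$. Degenerate Stirling numbers of the second kind: $(x)_{n,\mu}=\sum_{k=0}^{n}S_{2,\mu}(n,k)(x)_{k}$; degenerate Bell polynomials $\mathrm{Bel}_{n,\mu}(x)=\sum_{k=0}^{n}S_{2,\mu}(n,k)x^{k}$. Degenerate Whitney numbers of the second kind $W_{m,\lambda}(n,k)$: $(mx+1)_{n,\lambda}=\sum_{k=0}^{n}W_{m,\lambda}(n,k)m^{k}(x)_{k}$; degenerate Dowling polynomials $D_{m,\lambda}(n,x)=\sum_{k=0}^{n}W_{m,\lambda}(n,k)x^{k}$. *)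

(* Defs.v *)
From mathcomp Require Import all_boot all_order all_algebra.
From mathcomp Require Import boolp classical_sets reals.
From mathcomp Require Import ring.

Set Implicit Arguments.
Unset Strict Implicit.
Unset Printing Implicit Defensive.
Import Order.TTheory GRing.Theory Num.Theory.
Local Open Scope ring_scope.

(* (x)_{n,mu}; the ordinary falling factorial (x)_n is [dffact 1 n x]. *)
Definition dffact (R : realType) (mu : R) (n : nat) (x : R) : R :=
  \prod_(i < n) (x - i%:R * mu).

(* <x>_{n,mu} *)
Definition drfact (R : realType) (mu : R) (n : nat) (x : R) : R :=
  \prod_(i < n) (x + i%:R * mu).

(* The Stirling and Whitney numbers are defined by the expansion they are the
   coefficients of, with value 0 for n < k.  The arrays selected by [xget]
   exist and are unique: see [dstirling2P], [dstirling2_unique], [dwhitney2P]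
   and [dwhitney2_unique]. *)
Definition is_dstirling2 (R : realType) (mu : R) (S : nat -> nat -> R) : Prop :=
  (forall n k, (n < k)%N -> S n k = 0) /\
  (forall n x, dffact mu n x = \sum_(k < n.+1) S n k * dffact 1 k x).

Definition dstirling2 (R : realType) (mu : R) : nat -> nat -> R :=
  xget (fun _ _ => 0) [set S | is_dstirling2 mu S]%classic.

Definition dbell (R : realType) (mu : R) (n : nat) (x : R) : R :=
  \sum_(k < n.+1) dstirling2 mu n k * x ^+ k.

Definition is_dwhitney2 (R : realType) (m : nat) (lambda : R)
    (W : nat -> nat -> R) : Prop :=
  (forall n k, (n < k)%N -> W n k = 0) /\
  (forall n x, dffact lambda n (m%:R * x + 1) =
     \sum_(k < n.+1) W n k * m%:R ^+ k * dffact 1 k x).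

Definition dwhitney2 (R : realType) (m : nat) (lambda : R) : nat -> nat -> R :=
  xget (fun _ _ => 0) [set W | is_dwhitney2 m lambda W]%classic.

Definition ddowling (R : realType) (m : nat) (lambda : R) (n : nat) (x : R) : R :=
  \sum_(k < n.+1) dwhitney2 m lambda n k * x ^+ k.

Lemma dffact_affine_expand (R : realType) (a b mu : R) :
  exists c : nat -> nat -> R, (forall n k, (n < k)%N -> c n k = 0) /\
  (forall n x, dffact mu n (a * x + b) = \sum_(k < n.+1) c n k * dffact 1 k x).
Proof.
pose step n (d : nat -> R) k :=
  (if k is j.+1 then a * d j else 0) + (a * k%:R + b - n%:R * mu) * d k.
pose c := fix c n := if n is p.+1 then step p (c p) else fun k => (k == 0%N)%:R.
have c0 n k : (n < k)%N -> c n k = 0.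
  elim: n k => [|n IH] [|k] //= ltnk.
  by rewrite /step !IH ?mulr0 ?addr0 // ltnW.
exists c; split=> // n x; elim: n => [|n IH].
  by rewrite big_ord1 /dffact !big_ord0 mulr1.
rewrite {1}/dffact big_ord_recr /= -/(dffact mu n (a * x + b)) IH /step.
under [RHS]eq_bigr do rewrite mulrDl.
rewrite big_split /= [X in _ = X + _]big_ord_recl /= mul0r add0r.
rewrite [X in _ = _ + X]big_ord_recr /= (c0 n n.+1) // mulr0 mul0r addr0.
rewrite -big_split mulr_suml; apply: eq_bigr => k _ /=.
rewrite /bump /= add1n [dffact 1 k.+1 x]/dffact big_ord_recr /=.
by rewrite -/(dffact 1 k x); ring.
Qed.

Lemma dffact_coef_unique (R : realType) (n : nat) (c d : nat -> R) :
  (forall x, \sum_(k < n.+1) c k * dffact 1 k x =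
             \sum_(k < n.+1) d k * dffact 1 k x) ->
  forall k, (k <= n)%N -> c k = d k.
Proof.
move=> eq_cd k; elim/ltn_ind: k => k IH lekn.
have ff0 j : (k < j)%N -> dffact 1 j k%:R = 0 :> R.
  by move=> ltkj; rewrite /dffact (bigD1 (Ordinal ltkj)) //= mulr1 subrr mul0r.
have ffk : dffact 1 k k%:R != 0 :> R.
  apply/prodf_neq0 => i _.
  by rewrite mulr1 subr_eq0 eqr_nat gtn_eqF.
apply: (mulIf ffk); have := eq_cd k%:R; have ltkn : (k < n.+1)%N by [].
move/eqP.
rewrite -subr_eq0 -sumrB (bigD1 (Ordinal ltkn)) //= big1 ?addr0 ?subr_eq0 => [/eqP //|j].
rewrite -val_eqE /= neq_ltn => /orP[ltjk|ltkj]; last by rewrite ff0 // !mulr0 subrr.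
by rewrite IH ?subrr // ltnW // (leq_trans ltjk).
Qed.

Lemma dstirling2P (R : realType) (mu : R) : is_dstirling2 mu (dstirling2 mu).
Proof.
apply: (@xgetPex _ _ [set S | is_dstirling2 mu S]%classic).
have [c [c0 cE]] := dffact_affine_expand 1 0 mu.
by exists c; split=> // n x; rewrite -cE mul1r addr0.
Qed.

Lemma dstirling2_unique (R : realType) (mu : R) (S : nat -> nat -> R) :
  is_dstirling2 mu S -> S = dstirling2 mu.
Proof.
move=> [S0 SE]; have [T0 TE] := dstirling2P mu.
apply/funext => n; apply/funext => k.
have [lekn|ltnk] := leqP k n; last by rewrite S0 ?T0.
by apply: dffact_coef_unique lekn => x; rewrite -SE -TE.
Qed.

Lemma dwhitney2P (R : realType) (m : nat) (lambda : R) :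
  (0 < m)%N -> is_dwhitney2 m lambda (dwhitney2 m lambda).
Proof.
move=> m_gt0; apply: (@xgetPex _ _ [set W | is_dwhitney2 m lambda W]%classic).
have [c [c0 cE]] := dffact_affine_expand m%:R 1 lambda.
exists (fun n k => c n k / m%:R ^+ k); split=> [n k ltnk|n x].
  by rewrite c0 // mul0r.
by rewrite cE; apply: eq_bigr => k _; rewrite divfK // expf_neq0 // pnatr_eq0 -lt0n.
Qed.

Lemma dwhitney2_unique (R : realType) (m : nat) (lambda : R)
    (W : nat -> nat -> R) :
  (0 < m)%N -> is_dwhitney2 m lambda W -> W = dwhitney2 m lambda.
Proof.
move=> m_gt0 [W0 WE]; have [V0 VE] := dwhitney2P lambda m_gt0.
apply/funext => n; apply/funext => k.
have [lekn|ltnk] := leqP k n; last by rewrite W0 ?V0.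
have mk : m%:R ^+ k != 0 :> R by rewrite expf_neq0 // pnatr_eq0 -lt0n.
apply: (mulIf mk).
apply: (@dffact_coef_unique _ n (fun k => W n k * m%:R ^+ k)
          (fun k => dwhitney2 m lambda n k * m%:R ^+ k)) lekn => x.
by rewrite -WE -VE.
Qed.

(* Main.v *)
Require Import Defs.
From mathcomp Require Import all_boot all_order all_algebra.
From mathcomp Require Import reals.
From mathcomp Require Import ring.
Import Order.TTheory GRing.Theory Num.Theory.
Local Open Scope ring_scope.

(** Writing [m y = (m y + 1) - 1], the Vandermonde identity for [dffact lambda]
    together with [(-1)_{j,lambda} = (-1)^j <1>_{j,lambda}] expands
    [m^n (y)_{n,lambda/m} = (m y)_{n,lambda}] in terms of the
    [(m y + 1)_{k,lambda}].  Comparing the coefficients of [(y)_j] expresses the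
    Stirling numbers through the Whitney numbers; replacing [(y)_j] by [(x/m)^j]
    in the resulting identity gives the theorem. *)

Lemma dffactS (R : realType) (mu : R) (n : nat) (x : R) :
  dffact mu n.+1 x = dffact mu n x * (x - n%:R * mu).
Proof. by rewrite /dffact big_ord_recr. Qed.

(** Pascal's rule in summed form, the induction step for a binomial-type expansion: each term of the
    sum for [n] raises either its first or its second index. *)
Lemma sum_binS (R : pzRingType) (F : nat -> nat -> R) (n : nat) :
  \sum_(k < n.+2) 'C(n.+1, k)%:R * F k (n.+1 - k)%N =
  \sum_(k < n.+1) 'C(n, k)%:R * (F k.+1 (n - k)%N + F k (n - k).+1).
Proof.
rewrite big_ord_recl /= bin0.
under eq_bigr do rewrite /bump /= add1n subSS binS natrD mulrDl.
under [RHS]eq_bigr do rewrite mulrDr.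
rewrite !big_split /= addrA [RHS]addrC; congr (_ + _).
rewrite big_ord_recr /= bin_small // mul0r addr0 [RHS]big_ord_recl /= bin0 !subn0.
congr (_ + _); apply: eq_bigr => i _.
by rewrite /bump /= add1n subnSK.
Qed.

(** By induction: the new factor [x + y - n mu] splits as [(x - k mu) + (y - (n - k) mu)], and each
    summand prolongs one of the two products. *)
Lemma dffactD (R : realType) (mu : R) (n : nat) (x y : R) :
  dffact mu n (x + y) =
  \sum_(k < n.+1) 'C(n, k)%:R * (dffact mu k x * dffact mu (n - k) y).
Proof.
elim: n => [|n IH]; first by rewrite big_ord1 /dffact !big_ord0 !mulr1.
rewrite (sum_binS _ (fun i j => dffact mu i x * dffact mu j y)) dffactS IH mulr_suml.
apply: eq_bigr => k _; rewrite !dffactS.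
have -> : n%:R = k%:R + (n - k)%:R :> R by rewrite -natrD subnKC // -ltnS.
by ring.
Qed.

Lemma dffactN (R : realType) (mu : R) (n : nat) (x : R) :
  dffact mu n (- x) = (-1) ^+ n * drfact mu n x.
Proof.
rewrite /dffact /drfact -[n in (-1) ^+ n]card_ord -prodrN.
by apply: eq_bigr => i _; rewrite opprD.
Qed.

Lemma dffactZ (R : realType) (a mu : R) (n : nat) (x : R) :
  dffact (a * mu) n (a * x) = a ^+ n * dffact mu n x.
Proof.
rewrite /dffact -[n in a ^+ n]card_ord -prodr_const -big_split /=.
by apply: eq_bigr => i _; ring.
Qed.

(** Pads a triangular inner sum to a range independent of [k], so that the order of summation can be
    exchanged. *)
Lemma sum_ord_widen0 (V : nmodType) (k n : nat) (F : nat -> V) :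
  (k <= n)%N -> (forall j, (k < j)%N -> F j = 0) ->
  \sum_(j < k.+1) F j = \sum_(j < n.+1) F j.
Proof.
move=> lekn F0; rewrite (big_ord_widen n.+1 F) // big_mkcond /=.
by apply: eq_bigr => j _; case: ltnP => // /F0.
Qed.

Lemma dstirling2_dwhitney2 (R : realType) (m : nat) (lambda : R) (n j : nat) :
  (0 < m)%N -> (j <= n)%N ->
  m%:R ^+ n * dstirling2 (lambda / m%:R) n j =
  (\sum_(k < n.+1) 'C(n, k)%:R * (-1) ^+ (n - k) * drfact lambda (n - k) 1
                   * dwhitney2 m lambda k j) * m%:R ^+ j.
Proof.
move=> m_gt0; have m_neq0 : m%:R != 0 :> R by rewrite pnatr_eq0 -lt0n.
have [_ SE] := dstirling2P (lambda / m%:R).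
have [W0 WE] := dwhitney2P lambda m_gt0.
(* Both sides are read as coefficients of [dffact 1 j y]; the factor [m ^ j] on the right is the one
   in the expansion defining the Whitney numbers. *)
move: j; apply: dffact_coef_unique => y.
under eq_bigr do rewrite -mulrA.
rewrite -mulr_sumr -SE -dffactZ mulrC divfK // -[m%:R * y](addrK 1) dffactD.
under [RHS]eq_bigr do rewrite -mulrA mulr_suml.
rewrite exchange_big /=; apply: eq_bigr => k _; have lekn : (k <= n)%N by rewrite -ltnS.
rewrite dffactN WE (sum_ord_widen0 _ k n
  (fun j => dwhitney2 m lambda k j * m%:R ^+ j * dffact 1 j y)) //; last first.
  by move=> j ltkj; rewrite W0 // !mul0r.
rewrite mulr_suml mulr_sumr; apply: eq_bigr => j _; ring.
Qed.

Theorem theorem26 (R : realType) (m : nat) (lambda : R)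
    (m_gt0 : (0 < m)%N) (lambda_neq0 : lambda != 0) (n : nat) (x : R) :
  m%:R ^+ n * dbell (lambda / m%:R) n (x / m%:R) =
  \sum_(k < n.+1) 'C(n, k)%:R * (-1) ^+ (n - k) * drfact lambda (n - k) 1
                  * ddowling m lambda k x.
Proof.
have m_neq0 : m%:R != 0 :> R by rewrite pnatr_eq0 -lt0n.
have [W0 _] := dwhitney2P lambda m_gt0.
transitivity (\sum_(j < n.+1) (\sum_(k < n.+1) 'C(n, k)%:R * (-1) ^+ (n - k)
    * drfact lambda (n - k) 1 * dwhitney2 m lambda k j) * x ^+ j).
  rewrite /dbell mulr_sumr; apply: eq_bigr => j _.
  have lejn : (j <= n)%N by rewrite -ltnS.
  (* The factor [m ^ j] from the coefficient identity cancels the denominator of [(x / m) ^ j]. *)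
  by rewrite mulrA (dstirling2_dwhitney2 _ _ _ _ _ m_gt0 lejn) -mulrA -exprMn (mulrC m%:R) divfK.
under eq_bigr do rewrite mulr_suml.
rewrite exchange_big /=; apply: eq_bigr => k _; have lekn : (k <= n)%N by rewrite -ltnS.
rewrite /ddowling (sum_ord_widen0 _ k n
  (fun j => dwhitney2 m lambda k j * x ^+ j)) //; last first.
  by move=> j ltkj; rewrite W0 // mul0r.
by rewrite mulr_sumr; apply: eq_bigr => j _; rewrite mulrA.
Qed.
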